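(* Let $X$ be a non-degenerate real-valued random variable with $E[X]=0$ and $E[X^2]<\infty$. Then, with $X$ fixed, the function $\epsilon \mapsto L(X,\epsilon)$ is strictly decreasing and right continuous on $[0,\infty)$.
   Context: For a real-valued square-integrable random variable $X$ with mean $0$ and a real number $\epsilon \ge 0$, define $$\mathcal{V}_{\epsilon}(X) := \{ Y : Y \text{ is a real-valued random variable independent of } X,\ E[Y]=0 \text{ and } E[Y^2]\le \epsilon^2\},$$ $$L(X,\epsilon) := \inf_{Y\in \mathcal{V}_{\epsilon}(X)} \mathrm{var}\, E[X\mid X+Y].$$ Here $E[X\mid X+Y]$ is the conditional expectation of $X$ given $\sigma(X+Y)$. Non-degenerate means not almost surely constant. Convention: the underlying probability space is allowed to be enlarged, so that random variables with any prescribed law independent of the given ones are available. Since $\mathrm{var}\,E[X\mid X+Y]$ depends only on the joint law of $(X,Y)$, membership in $\mathcal{V}_\epsilon(X)$ and the infimum may equivalently be understood as ranging over all probability laws of $Y$ on $\mathbb{R}$ with mean $0$ and second moment at most $\epsilon^2$, with $(X,Y)$ having the product law. *)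

(* Defs.v *)
From HB Require Import structures.
From mathcomp Require Import all_boot all_order all_algebra.
From mathcomp Require Import all_classical all_reals all_analysis.

Set Implicit Arguments.
Unset Strict Implicit.
Unset Printing Implicit Defensive.

Import Order.TTheory GRing.Theory Num.Theory.
Import numFieldNormedType.Exports.

Local Open Scope classical_set_scope.
Local Open Scope ring_scope.

Definition indep_RV {d : measure_display} {T : measurableType d} {R : realType}
    (P : probability T R) (X Y : T -> R) : Prop :=
  forall A B : set R, measurable A -> measurable B ->
    P (X @^-1` A `&` Y @^-1` B) = (P (X @^-1` A) * P (Y @^-1` B))%E.

Definition sigma_RV {T : Type} {R : realType} (S : T -> R) : set (set T) :=
  preimage_set_system setT S measurable.

(* Conditional expectations are only defined up to P-null sets: this says that
   Z is a version of E[X | G], where G is a sub-sigma-algebra of the measurable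
   sets of T. *)
Definition is_cond_exp {d : measure_display} {T : measurableType d}
    {R : realType} (P : probability T R) (X : T -> R) (G : set (set T))
    (Z : T -> R) : Prop :=
  [/\ forall B : set R, measurable B -> G (Z @^-1` B),
      P.-integrable setT (EFin \o Z) &
      forall A : set T, G A ->
        (\int[P]_(w in A) (Z w)%:E = \int[P]_(w in A) (X w)%:E)%E].

Definition nondegenerate_RV {d : measure_display} {T : measurableType d}
    {R : realType} (P : probability T R) (X : T -> R) : Prop :=
  ~ exists c : R, {ae P, forall w, X w = c}.

(* The set V_eps(X).  The library integral of a non-integrable function is a
   junk value, but the bound on the second moment makes Y integrable. *)
Definition noise {d : measure_display} {T : measurableType d} {R : realType}
    (P : probability T R) (X : T -> R) (eps : R) : set {RV P >-> R} :=
  [set Y : {RV P >-> R} |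
    [/\ indep_RV P X Y,
        ('E_P[Y : T -> R] = 0)%E &
        ('E_P[fun w => (Y w ^+ 2)%R] <= (eps ^+ 2)%:E)%E]].

(* An enlargement of the probability space (T, P): a probability space
   (T', P') with a measurable map p : T' -> T sending P' to P.  A random
   variable X on T is viewed on T' as X \o p. *)
Definition enlargement {d d' : measure_display} {T : measurableType d}
    {T' : measurableType d'} {R : realType} (P : probability T R)
    (P' : probability T' R) (p : T' -> T) : Prop :=
  measurable_fun setT p /\
  forall A : set T, measurable A -> P' (p @^-1` A) = P A.

(* The infimum L(X, eps) of var E[X | X + Y] over Y in V_eps(X), where Y may
   live on any enlargement of the space carrying X.  All versions Z of
   E[X | X + Y] have the same variance. *)
Definition inf_var_cond_exp {d : measure_display} {T : measurableType d} {R : realType}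
    (P : probability T R) (X : T -> R) (eps : R) : \bar R :=
  ereal_inf [set v : \bar R |
    exists (d' : measure_display) (T' : measurableType d')
           (P' : probability T' R) (p : T' -> T) (Y : {RV P' >-> R})
           (Z : T' -> R),
      [/\ enlargement P P' p,
          noise (X \o p) eps Y,
          is_cond_exp P' (X \o p)
            (sigma_RV (fun w => (X \o p) w + Y w)) Z &
          v = 'V_P'[Z]%E]].

(* Main.v *)
Require Import Defs.
From HB Require Import structures.
From mathcomp Require Import all_boot all_order all_algebra.
From mathcomp Require Import all_classical all_reals all_analysis.
From mathcomp Require Import measurable_realfun ring lra.

Set Implicit Arguments.
Unset Strict Implicit.
Unset Printing Implicit Defensive.

Import Order.TTheory GRing.Theory Num.Theory.
Import numFieldNormedType.Exports.
Import HBNNSimple.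

Local Open Scope classical_set_scope.
Local Open Scope ring_scope.
(** Write nu for the law of X, s for its second moment, and F(mu) for
    var E[X | X + Y] when Y has law mu and is independent of X.  Since E[X | S]
    is an orthogonal projection,
      F(mu) = sup over bounded measurable g of E[2 X g(X + Y) - g(X + Y)^2],
    and for a fixed g the right-hand side is an integral against mu, of the
    function [score nu g].  So F(mu) <= C is the family of linear constraints
    [explained_le nu mu C] on mu, and F is a convex function of mu.  The pairs
    (v, C) such that F(mu) <= C for some centered mu of second moment at most v
    are those for which [attainable nu v C] holds; L(X, eps) is the infimum of
    the C attainable at v = eps^2 ([value_le], [value_ge]).  Passing from one
    description to the other takes two facts about conditional expectations:
    every version obeys the variational inequality ([variance_cond_exp]), and
    the constraints are saturated by an actual conditional expectation h(X + Y),
    where h is a Radon-Nikodym density ([explained_le_projection],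
    [inf_var_cond_exp_le]).

    The theorem follows from four properties of the attainable pairs.
    - They form a convex set, because laws can be mixed
      ([attainable_convex]).
    - The pair (0, s) is attainable, by the absence of noise ([attainable0]).
    - A linear g = c x gives C >= 2 c s - c^2 (s + v) ([attainable_ge]).  In
      particular the infimum is positive at every v, and it is at least s - v.
    - If C is attainable at v, then C / 2 is attainable at 6 v + 4 s
      ([attainable_half]): add to Y an independent copy S' of S = X + Y.  By
      exchangeability E[X | S + S'] is the projection of (h(S) + h(S')) / 2,
      a mean of two independent centered variables with variance at most C.

    Strict decrease: mixing a noise law with a small weight t of its halved
    version moves v by an arbitrarily small amount and multiplies C by
    1 - t / 2, and the infimum is positive.  Right continuity at eps > 0: mixing
    a noise law of second moment x^2 > eps^2 with no noise brings its second
    moment back to eps^2 at a cost of order x^2 - eps^2.  At eps = 0 the bounds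
    s - x^2 and s squeeze the infimum. *)

(** * Real-valued integration against a probability *)
Notation Int P f := (P.-integrable setT (EFin \o f)).

Definition bounded_measurable d (T : measurableType d) (R : realType)
    (g : T -> R) : Prop :=
  measurable_fun setT g /\ exists M, forall x, `|g x| <= M.

Section real_integrals.
Context d (T : measurableType d) (R : realType) (P : probability T R).
Implicit Types f g : T -> R.

Lemma Int_measurable f : Int P f -> measurable_fun setT f.
Proof. by move=> /measurable_int/measurable_EFinP. Qed.

Lemma Int_le f g : measurable_fun setT f -> (forall x, `|f x| <= g x) ->
  Int P g -> Int P f.
Proof.
move=> mf fg; apply: le_integrable => //; first exact/measurable_EFinP.
by move=> x _ /=; rewrite lee_fin (le_trans (fg x))// ler_norm.
Qed.

Lemma IntD f g : Int P f -> Int P g -> Int P (fun x => f x + g x).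
Proof.
by move=> If Ig; have := integrableD measurableT If Ig; apply: eq_integrable.
Qed.

Lemma IntB f g : Int P f -> Int P g -> Int P (fun x => f x - g x).
Proof.
by move=> If Ig; have := integrableB measurableT If Ig; apply: eq_integrable.
Qed.

Lemma IntZ k f : Int P f -> Int P (fun x => k * f x).
Proof.
by move=> If; have := integrableZl measurableT k If; apply: eq_integrable.
Qed.

Lemma Int_cst k : Int P (fun=> k).
Proof.
have := @finite_measure_integrable_cst _ T R P setT k measurableT.
exact: eq_integrable.
Qed.

Lemma Int_bounded g : bounded_measurable g -> Int P g.
Proof.
move=> [mg [M gM]]; apply: (@Int_le g (fun=> M)) => //; exact: Int_cst.
Qed.

Lemma IntM_bounded f g : Int P f -> bounded_measurable g ->
  Int P (fun x => f x * g x).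
Proof.
move=> If [mg [M gM]].
apply: (@Int_le _ (fun x => M * `|f x|)).
- by apply: measurable_funM => //; exact: Int_measurable.
- by move=> x; rewrite normrM mulrC ler_wpM2r.
- by apply: IntZ; exact: integrable_norm.
Qed.

Lemma Rint_cst k : \int[P]_x k = k.
Proof.
rewrite Rintegral_cst// [X in fine X](_ : _ = 1%E) ?mulr1//.
exact: probability_setT.
Qed.

Lemma EFin_Rint f : Int P f -> (\int[P]_x (f x)%:E)%E = (\int[P]_x f x)%:E.
Proof. by move=> If; rewrite /Rintegral fineK//; exact: integrable_fin_num. Qed.

Lemma RintD f g : Int P f -> Int P g ->
  \int[P]_x (f x + g x) = \int[P]_x f x + \int[P]_x g x.
Proof. exact: RintegralD. Qed.

Lemma RintB f g : Int P f -> Int P g ->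
  \int[P]_x (f x - g x) = \int[P]_x f x - \int[P]_x g x.
Proof. exact: RintegralB. Qed.

Lemma RintZ k f : Int P f -> \int[P]_x (k * f x) = k * \int[P]_x f x.
Proof. exact: RintegralZl. Qed.

Lemma Rint_le f g : Int P f -> Int P g -> (forall x, f x <= g x) ->
  \int[P]_x f x <= \int[P]_x g x.
Proof. by move=> If Ig fg; apply: le_Rintegral. Qed.

Lemma Rint_dominated_cvg (f_ : nat -> T -> R) f g :
  (forall n, measurable_fun setT (f_ n)) ->
  (forall x, f_ n x @[n --> \oo] --> f x) -> Int P g ->
  (forall n x, `|f_ n x| <= g x) ->
  Int P f /\ \int[P]_x f_ n x @[n --> \oo] --> \int[P]_x f x.
Proof.
move=> mf_ f_f Ig f_g.
have mf : measurable_fun setT f.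
  by apply: (@measurable_fun_cvg _ _ _ setT f_) => // x _; exact: f_f.
have If_ n : Int P (f_ n) by apply: Int_le Ig => // x; exact: f_g.
have [||||| If _ cv] := @dominated_convergence _ T R P setT measurableT
  (fun n x => (f_ n x)%:E) (EFin \o f) (EFin \o g).
- by move=> n; exact/measurable_EFinP.
- exact/measurable_EFinP.
- by apply/aeW => x _ /=; apply: cvg_EFin; [exact: nearW|exact: f_f].
- exact: Ig.
- by apply/aeW => x n _ /=; rewrite lee_fin.
split => //; apply: fine_cvg.
by rewrite -EFin_Rint.
Qed.

(** Square integrability always enters through a finite bound on an extended
    real second moment, the form in which the definitions provide it. *)
Lemma ge0_Int f (c : R) : measurable_fun setT f -> (forall x, 0 <= f x) ->
  (\int[P]_x (f x)%:E <= c%:E)%E -> Int P f.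
Proof.
move=> mf f0 fc; apply/integrableP; split; first exact/measurable_EFinP.
apply: le_lt_trans (ltry c); apply: le_trans fc; rewrite le_eqVlt; apply/orP; left.
by apply/eqP/eq_integral => x _ /=; rewrite ger0_norm.
Qed.

End real_integrals.

(** * Laws, change of variables and Fubini *)
Section laws.
Context d1 d2 (T : measurableType d1) (U : measurableType d2) (R : realType).
Implicit Types (P : probability T R) (X : T -> U) (l : probability U R).

Definition mfun_of X (mX : measurable_fun setT X) : {mfun T >-> U} :=
  MeasurableFun.Pack (MeasurableFun.Class (isMeasurableFun.Build _ _ T U X mX)).

(** A relation rather than [distribution P X]: the same [l] serves as the law of
    variables living on different spaces, which is how all computations are
    brought down to the line. *)
Definition has_law P X l : Prop :=
  measurable_fun setT X /\
  forall B, measurable B -> P (X @^-1` B) = l B.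

Lemma has_law_exists P X : measurable_fun setT X -> exists l, has_law P X l.
Proof.
move=> mX.
pose Xm := mfun_of mX.
by exists (distribution P Xm); split.
Qed.

Lemma has_law_Int P X l (f : U -> R) : has_law P X l -> measurable_fun setT f ->
  Int l f <-> Int P (f \o X).
Proof.
move=> [mX lE] mf.
pose Xm := mfun_of mX.
have E : (\int[l]_x `|(f x)%:E| = \int[P]_x `|(f (X x))%:E|)%E.
  rewrite -(@ge0_integral_distribution _ _ T U R P Xm (fun x => `|(f x)%:E|%E))//; last first.
    by apply: measurableT_comp => //; exact/measurable_EFinP.
  by apply: eq_measure_integral => A mA _; have := lE A mA; rewrite /= => <-.
have mfX : measurable_fun setT (f \o X) by exact: measurableT_comp.
split => /integrableP[_ h]; apply/integrableP; split => //.
- exact/measurable_EFinP.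
- by rewrite /= -E.
- exact/measurable_EFinP.
- by rewrite /= E.
Qed.

Lemma has_law_Rint P X l (f : U -> R) : has_law P X l -> measurable_fun setT f ->
  Int l f -> \int[l]_x f x = \int[P]_x f (X x).
Proof.
move=> XL mf /(has_law_Int XL mf) If; have [mX lE] := XL.
pose Xm := mfun_of mX.
congr fine.
rewrite -[RHS](@integral_distribution _ _ T U R P Xm (EFin \o f))//; last exact/measurable_EFinP.
by apply: eq_measure_integral => A mA _; have := lE A mA; rewrite /= => <-.
Qed.

End laws.

Section fubini.
Context d1 d2 (T : measurableType d1) (U : measurableType d2) (R : realType).
Variables (P : probability T R) (Q : probability U R) (f : T * U -> R).
Hypothesis If : Int (P \x Q)%E f.

(** Integrability of every section, and not of almost every one, is assumed so
    that the real-valued inner integral has no junk values. *)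
Lemma Rint_prod12 : (forall x, Int Q (fun y => f (x, y))) ->
  Int P (fun x => \int[Q]_y f (x, y)) /\
  \int[(P \x Q)%E]_z f z = \int[P]_x \int[Q]_y f (x, y).
Proof.
move=> I1.
have E : EFin \o (fun x => \int[Q]_y f (x, y)) =
    fubini_F Q (EFin \o f).
  by apply/funext => x /=; rewrite /fubini_F EFin_Rint.
split; first by rewrite E; exact: integrable_fubini_F.
by congr fine; rewrite -integral12_prod_meas1//; apply: eq_integral => x _; rewrite -E.
Qed.

Lemma Rint_prod21 : (forall y, Int P (fun x => f (x, y))) ->
  Int Q (fun y => \int[P]_x f (x, y)) /\
  \int[(P \x Q)%E]_z f z = \int[Q]_y \int[P]_x f (x, y).
Proof.
move=> I1.
have E : EFin \o (fun y => \int[P]_x f (x, y)) =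
    fubini_G P (EFin \o f).
  by apply/funext => x /=; rewrite /fubini_G EFin_Rint.
split.
  rewrite E; have mf := measurable_int _ If.
  apply/integrableP; split; first exact: (measurable_fubini_G If).
  apply: le_lt_trans ((integrable21ltyP P Q mf).1 If).
  apply: ge0_le_integral => //.
  - by apply: measurableT_comp => //; exact: (measurable_fubini_G If).
  - apply: (measurable_fun_fubini_tonelli_G (abse \o (EFin \o f))) => //=.
    exact: measurableT_comp.
  - move=> y _; apply: le_abse_integral => //.
    exact: (measurable_int _ (I1 y)).
by congr fine; rewrite -integral21_prod_meas1//; apply: eq_integral => x _; rewrite -E.
Qed.

End fubini.
(** * Conditional expectation given a random variable *)
Section levels.
Context d (T : measurableType d) (R : realType) (P : probability T R).
Implicit Types f g : T -> R.

Lemma Rint_indic (A : set T) f :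
  \int[P]_(x in A) f x = \int[P]_x (f x * \1_A x).
Proof. by rewrite Rintegral_mkcond patch_indic. Qed.

Lemma bounded_measurable_indic (B : set T) :
  measurable B -> bounded_measurable (\1_B : T -> R).
Proof.
move=> mB; split; first exact: measurable_indic.
by exists 1 => x; rewrite indicE; case: (_ \in _); rewrite ?normr1 ?normr0.
Qed.

Lemma bounded_measurable_cst k : bounded_measurable (fun _ : T => k : R).
Proof. by split; [exact: measurable_cst|exists `|k|]. Qed.

Lemma bounded_measurableD f g : bounded_measurable f -> bounded_measurable g ->
  bounded_measurable (fun x => f x + g x).
Proof.
move=> [mf [M fM]] [mg [N gN]]; split; first exact: measurable_funD.
by exists (M + N) => x; rewrite (le_trans (ler_normD _ _))// lerD.
Qed.

Lemma bounded_measurableM f g : bounded_measurable f -> bounded_measurable g ->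
  bounded_measurable (fun x => f x * g x).
Proof.
move=> [mf [M fM]] [mg [N gN]]; split; first exact: measurable_funM.
by exists (M * N) => x; rewrite normrM ler_pM.
Qed.

End levels.

Lemma bounded_measurable_comp d1 d2 (T : measurableType d1)
    (U : measurableType d2) (R : realType) (S : T -> U) (g : U -> R) :
  measurable_fun setT S -> bounded_measurable g ->
  bounded_measurable (fun x => g (S x)).
Proof.
move=> mS [mg [M gM]]; split; first exact: (measurableT_comp mg mS).
by exists M => x.
Qed.

Section levels_theorem.
Context d1 d2 (T : measurableType d1) (U : measurableType d2) (R : realType).
Variables (P : probability T R) (S : T -> U) (D : T -> R).
Hypotheses (mS : measurable_fun setT S) (ID : Int P D).
Hypothesis D0 : forall B, measurable B -> \int[P]_x (D x * \1_B (S x)) = 0.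

(** A simple function of S is a combination of indicators of level sets of S. *)
Lemma Rint_nnsfun_eq0 (phi : {nnsfun U >-> R}) :
  \int[P]_x (D x * phi (S x)) = 0.
Proof.
suff H s : Int P (fun x => D x * \sum_(r <- s) (r * \1_(phi @^-1` [set r]) (S x))) /\
    \int[P]_x (D x * \sum_(r <- s) (r * \1_(phi @^-1` [set r]) (S x))) = 0.
  rewrite -[RHS](H (finmap.enum_fset (fset_set (range phi)))).2; apply: eq_Rintegral => x _.
  by rewrite fimfunE fsbig_finite//=.
have bm r : bounded_measurable (fun x => (\1_(phi @^-1` [set r]) (S x) : R)).
  apply: (bounded_measurable_comp mS).
  by apply: bounded_measurable_indic; exact: measurable_funPTI.
elim: s => [|r s [Is IHs]].
  rewrite (_ : (fun _ => _) = fun=> 0); last by apply/funext => x; rewrite big_nil mulr0.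
  by rewrite Rint_cst; split => //; exact: Int_cst.
rewrite (_ : (fun _ => _) = fun x => r * (D x * \1_(phi @^-1` [set r]) (S x)) +
    (D x * \sum_(r <- s) (r * \1_(phi @^-1` [set r]) (S x)))); last first.
  by apply/funext => x; rewrite big_cons mulrDr mulrCA.
have I1 : Int P (fun x => D x * \1_(phi @^-1` [set r]) (S x)).
  exact: IntM_bounded.
split; first by apply: IntD => //; exact: IntZ.
rewrite RintD ?RintZ ?IHs ?D0 ?mulr0 ?addr0//; last exact: IntZ.
Qed.

(** Orthogonality to the events of sigma(S) extends to bounded functions of S, by
    approximation by simple functions and dominated convergence. *)
Lemma Rint_bounded_eq0 (g : U -> R) : bounded_measurable g ->
  \int[P]_x (D x * g (S x)) = 0.
Proof.
(* Adding a constant to g makes it nonnegative and costs nothing. *)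
suff H (f : U -> R) : bounded_measurable f -> (forall y, 0 <= f y) ->
    \int[P]_x (D x * f (S x)) = 0.
  move=> bg; have [mg [M gM]] := bg.
  have bgM : bounded_measurable (fun y => g y + M).
    by apply: bounded_measurableD => //; exact: bounded_measurable_cst.
  have := H _ bgM; rewrite (_ : (fun x => D x * (g (S x) + M)) =
     fun x => D x * g (S x) + M * D x); last by apply/funext => x; rewrite mulrDr [M * _]mulrC.
  have IDg : Int P (fun x => D x * g (S x)).
    by apply: IntM_bounded => //; exact: bounded_measurable_comp.
  rewrite RintD ?RintZ//; last exact: IntZ.
  have -> : \int[P]_x D x = 0.
    rewrite -[RHS](D0 measurableT); apply: eq_Rintegral => x _.
    by rewrite indicT mulr1.
  rewrite mulr0 addr0; apply => y; have := gM y; rewrite ler_norml => /andP[+ _].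
  by rewrite -lerBlDr sub0r.
move=> [mf [M fM]] f0.
have mEf : measurable_fun setT (EFin \o f) by exact/measurable_EFinP.
pose phi := nnsfun_approx measurableT mEf.
have f0' y : [set: U] y -> (0 <= (EFin \o f) y)%E by rewrite lee_fin.
have phif n y : phi n y <= f y.
  by rewrite -lee_fin /phi nnsfun_approxE; exact: le_approx.
have [|||| _ ] := @Rint_dominated_cvg _ _ _ P (fun n x => D x * phi n (S x))
  (fun x => D x * f (S x)) (fun x => M * `|D x|).
- move=> n; apply: measurable_funM; first exact: Int_measurable ID.
  exact: measurableT_comp.
- move=> x; apply: cvgM; first exact: cvg_cst.
  exact: (fine_cvg (cvg_nnsfun_approx measurableT mEf f0' (x := S x) I)).
- by apply: IntZ; exact: integrable_norm.
- move=> n x; rewrite normrM mulrC ler_wpM2r//.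
  by rewrite ger0_norm ?fun_ge0// (le_trans (phif _ _))// (le_trans (ler_norm _)).
have -> : (fun n => \int[P]_x (D x * phi n (S x))) = fun=> 0.
  by apply/funext => n; exact: Rint_nnsfun_eq0.
move=> h; apply/eqP; rewrite -(cvg_lim _ h)//.
by apply/eqP; apply: lim_cst.
Qed.

End levels_theorem.

Section law_pair.
Context d (T : measurableType d) (R : realType).
Variables (P : probability T R) (X Y : T -> R) (nu mu : probability R R).

Lemma has_law_pair : has_law P X nu -> has_law P Y mu -> indep_RV P X Y ->
  has_law P (fun w => (X w, Y w)) (nu \x mu)%E.
Proof.
move=> [mX nuE] [mY muE] XY.
have mXY : measurable_fun setT (fun w => (X w, Y w)) by exact: measurable_fun_pair.
have [l [_ lE]] := has_law_exists P mXY.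
split => // B mB; rewrite lE//; apply/esym/product_measure_unique => // A C mA mC.
rewrite -[LHS](lE (A `*` C) (measurableX mA mC)).
by have := XY A C mA mC; rewrite nuE// muE// => <-.
Qed.

End law_pair.

Section conditional_expectation.
Context d1 d2 (T : measurableType d1) (U : measurableType d2) (R : realType).
Variables (P : probability T R) (S : T -> U) (l : probability U R) (D : T -> R).
Hypotheses (Sl : has_law P S l) (ID : Int P D).

(** The density of the image under S of the signed measure D.P with respect to
    the law of S. *)
Lemma RN_levels : exists h : U -> R, Int l h /\
  forall B, measurable B -> \int[P]_x (D x * \1_B (S x)) = \int[l]_y (h y * \1_B y).
Proof.
have [mS lE] := Sl.
have [nu nuE] : exists nu : {charge set U -> \bar R},
    nu = pushforward (induced_charge ID) S :> (set U -> \bar R).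
  by unshelve (eexists (pushforward (induced_charge ID) S)).
have mSB B : measurable B -> measurable (S @^-1` B).
  by move=> mB; rewrite -[X in measurable X]setTI; exact: mS.
have nul : nu `<< l.
  apply/null_content_dominatesP => B mB lB; rewrite nuE /pushforward /induced_charge.
  apply: null_set_integral => //; first exact: mSB.
    by apply: measurable_funTS; exact: (measurable_int _ ID).
  by rewrite /= lE.
pose h y := fine (Radon_Nikodym nu l y).
have hE : EFin \o h = Radon_Nikodym nu l.
  by apply/funext => y; rewrite /= /h fineK// Radon_Nikodym_fin_num.
exists h; split; first by rewrite hE; exact: Radon_Nikodym_integrable.
move=> B mB; rewrite -(Rint_indic l) /Rintegral.
have -> : (\int[l]_(x in B) (h x)%:E = \int[l]_(x in B) Radon_Nikodym nu l x)%E.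
  by rewrite -hE.
rewrite -Radon_Nikodym_integral// nuE /pushforward /induced_charge.
rewrite [RHS](_ : _ = \int[P]_(x in S @^-1` B) D x)//.
by rewrite Rint_indic.
Qed.

(** [h] is E[D | S] as a function of the value of S: working on the line from the
    start produces the factorization through S. *)
Lemma conditional_expectation_law : exists h : U -> R, Int l h /\
  forall g, bounded_measurable g ->
    \int[P]_x (D x * g (S x)) = \int[l]_y (h y * g y).
Proof.
have [mS lE] := Sl.
have [h [Ih hE]] := RN_levels.
have mh := Int_measurable Ih.
exists h; split => // g bg.
have IhS : Int P (h \o S) by apply/(has_law_Int Sl mh).
have bgS := bounded_measurable_comp mS bg.
have hlaw k : bounded_measurable k ->
    \int[l]_y (h y * k y) = \int[P]_x (h (S x) * k (S x)).
  move=> bk; apply: (has_law_Rint Sl); last exact: IntM_bounded.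
  by apply: measurable_funM => //; case: bk.
have := @Rint_bounded_eq0 _ _ _ _ _ P S (fun x => D x - h (S x)) mS
  (IntB ID IhS) _ g bg.
rewrite (_ : (fun _ => _) = fun x => D x * g (S x) - h (S x) * g (S x)); last first.
  by apply/funext => x; rewrite mulrBl.
rewrite RintB; [|exact: IntM_bounded..].
rewrite hlaw// => /(_ _)/subr0_eq; apply => B mB.
have bB := bounded_measurable_indic R mB.
have bBS := bounded_measurable_comp mS bB.
rewrite (_ : (fun _ => _) = fun x => D x * \1_B (S x) - h (S x) * \1_B (S x)); last first.
  by apply/funext => x; rewrite mulrBl.
rewrite RintB; [|exact: IntM_bounded..].
by rewrite hE// hlaw// subrr.
Qed.

End conditional_expectation.
(** * The variational description of the explained variance *)
Section fatou.
Context d (T : measurableType d) (R : realType) (P : probability T R).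

(** How square integrability of a conditional expectation is obtained: from a
    uniform bound on its truncations. *)
Lemma Rint_fatou (f_ : nat -> T -> R) (f : T -> R) (C : R) :
  (forall n x, 0 <= f_ n x) -> (forall n, Int P (f_ n)) ->
  (forall n, \int[P]_x f_ n x <= C) ->
  (forall x, f_ n x @[n --> \oo] --> f x) ->
  Int P f /\ \int[P]_x f x <= C.
Proof.
move=> f0 If fC f_f.
have mf : measurable_fun setT f.
  apply: (@measurable_fun_cvg _ _ _ setT f_) => [n|x _]; first exact: Int_measurable (If n).
  exact: f_f.
have f_ge0 x : 0 <= f x by apply: (cvgr_to_ge (f_f x)); exact: nearW.
have fE x : (limn_einf (fun n => (f_ n x)%:E) = (f x)%:E)%E.
  have cv : (f_ n x)%:E @[n --> \oo] --> (f x)%:E.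
    by apply: cvg_EFin; [exact: nearW|exact: f_f].
  rewrite is_cvg_limn_einfE; first exact/cvg_lim.
  by apply/cvg_ex; exists (f x)%:E.
have lec : (\int[P]_x (f x)%:E <= C%:E)%E.
  have := @fatou _ T R P setT measurableT (fun n x => (f_ n x)%:E) _ _.
  under eq_integral do rewrite fE.
  move=> /(_ _ _)/le_trans; apply.
  - by move=> n; exact: (measurable_int _ (If n)).
  - by move=> n x _; rewrite lee_fin.
  - rewrite limn_einf_lim; apply: lime_le; first exact: is_cvg_einfs.
    apply: nearW => n; apply: (@le_trans _ _ (\int[P]_x (f_ n x)%:E)%E).
      by apply: ereal_inf_lbound; exists n => /=.
    by rewrite EFin_Rint// lee_fin.
have I := ge0_Int mf f_ge0 lec.
by split => //; rewrite -lee_fin -EFin_Rint.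
Qed.

End fatou.

Section truncation.
Context (R : realType).

(** Cutting to zero instead of clamping gives [trunc_sqr], which makes the
    variational functional of a truncation equal to its second moment. *)
Definition trunc (n : nat) (x : R) : R := x * \1_(`[- n%:R, n%:R]%classic) x.

Lemma truncE n x : trunc n x = if `|x| <= n%:R then x else 0.
Proof.
rewrite /trunc indicE mem_setE in_itv/= -ler_norml.
by case: ifP; rewrite ?mulr1 ?mulr0.
Qed.

Lemma norm_trunc_le n x : `|trunc n x| <= `|x|.
Proof. by rewrite truncE; case: ifP => // _; rewrite normr0. Qed.

Lemma trunc_sqr n x : trunc n x ^+ 2 = x * trunc n x.
Proof. by rewrite truncE; case: ifP => // _; rewrite mulr0 expr0n. Qed.

Lemma trunc_cvg x : trunc n x @[n --> \oo] --> x.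
Proof.
apply: cvg_near_cst; near=> n; rewrite truncE ifT//.
by near: n; exact: nbhs_infty_ger.
Unshelve. all: end_near. Qed.

Lemma bounded_measurable_trunc n : bounded_measurable (trunc n).
Proof.
split; first by apply: measurable_funM => //; exact: measurable_indic.
by exists n%:R => x; rewrite truncE; case: ifP => // _; rewrite normr0.
Qed.

End truncation.

Section product_laws.
Context d1 d2 (T : measurableType d1) (U : measurableType d2) (R : realType).
Variables (P : probability T R) (Q : probability U R).

Lemma has_law_fst : has_law (P \x Q)%E fst P.
Proof.
split; first exact: measurable_fst.
move=> B mB.
have := @product_measure1E _ _ T U R P Q B setT mB measurableT.
rewrite [X in (_ * X)%E](_ : _ = 1%E) ?mule1; last exact: probability_setT.
by move=> <-; congr (_ _); apply/seteqP; split => -[x y] /=; tauto.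
Qed.

Lemma has_law_snd : has_law (P \x Q)%E snd Q.
Proof.
split; first exact: measurable_snd.
move=> B mB.
have := @product_measure1E _ _ T U R P Q setT B measurableT mB.
rewrite [X in (X * _)%E](_ : _ = 1%E) ?mul1e; last exact: probability_setT.
by move=> <-; congr (_ _); apply/seteqP; split => -[x y] /=; tauto.
Qed.

End product_laws.

Lemma Int_sqr_Int d (T : measurableType d) (R : realType) (P : probability T R)
    (f : T -> R) : measurable_fun setT f -> Int P (fun x => f x ^+ 2) -> Int P f.
Proof.
move=> mf I2; apply: (@Int_le _ _ _ _ _ (fun x => 1 + f x ^+ 2)) => //.
  by move=> x; rewrite -[f x ^+ 2]real_normK ?num_real//; nra.
by apply: IntD => //; exact: Int_cst.
Qed.

Section score.
Context (R : realType) (nu : probability R R).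
Hypothesis Inu : Int nu (fun x => x).
Implicit Types (mu : probability R R) (g : R -> R).

(** The variational functional at a fixed value [y] of the noise: averaged over y
    and maximized over [g], it yields var E[X | X + Y]. *)
Definition score g (y : R) : R :=
  \int[nu]_x (2 * (x * g (x + y)) - g (x + y) ^+ 2).

(** For [nu] centered and X, Y independent of laws [nu], [mu], this is the
    inequality var E[X | X + Y] <= C, in a form that is linear in [mu]. *)
Definition explained_le mu (C : R) : Prop :=
  forall g, bounded_measurable g -> \int[mu]_y score g y <= C.

Lemma bounded_measurable_sqr d (T : measurableType d) (g : T -> R) :
  bounded_measurable g -> bounded_measurable (fun x => g x ^+ 2).
Proof. by move=> bg; exact: (bounded_measurableM bg bg). Qed.

Lemma Int_score_integrand d (T : measurableType d) (P : probability T R)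
  (f k : T -> R) : Int P f -> bounded_measurable k ->
  Int P (fun x => 2 * (f x * k x) - k x ^+ 2).
Proof.
move=> If bk; apply: IntB; last by apply: Int_bounded; exact: bounded_measurable_sqr.
by apply: IntZ; exact: IntM_bounded.
Qed.

Lemma Rint_score mu g : bounded_measurable g ->
  Int mu (score g) /\
  \int[mu]_y score g y =
  \int[(nu \x mu)%E]_z (2 * (z.1 * g (z.1 + z.2)) - g (z.1 + z.2) ^+ 2).
Proof.
move=> bg.
have [||I1 I2] := @Rint_prod21 _ _ _ _ _ nu mu
  (fun z : R * R => 2 * (z.1 * g (z.1 + z.2)) - g (z.1 + z.2) ^+ 2).
- apply: (@Int_score_integrand _ _ (nu \x mu)%E (@fst R R)).
    exact: ((has_law_Int (has_law_fst nu mu) (@measurable_id _ R setT)).1 Inu).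
  by apply: bounded_measurable_comp bg; exact: measurable_funD.
- move=> y /=; apply: (@Int_score_integrand _ _ nu (fun x => x)) => //.
  by apply: bounded_measurable_comp bg; exact: measurable_funD.
- by split => //; rewrite I2.
Qed.

(** [h] is the conditional expectation of X given X + Y.  Testing the constraint
    on a truncation of [h] itself bounds the second moment of that truncation by
    C, and the truncation level is then sent to infinity. *)
Lemma explained_le_projection mu C (l : probability R R) :
  has_law (nu \x mu)%E (fun z => z.1 + z.2) l -> explained_le mu C ->
  exists h : R -> R, [/\ Int l h, Int l (fun s => h s ^+ 2),
    \int[l]_s h s ^+ 2 <= C &
    forall g, bounded_measurable g ->
    \int[(nu \x mu)%E]_z (z.1 * g (z.1 + z.2)) = \int[l]_s (h s * g s)].
Proof.
move=> Sl muC.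
have I1 : Int (nu \x mu)%E (fun z : R * R => z.1).
  exact: ((has_law_Int (has_law_fst nu mu) (@measurable_id _ R setT)).1 Inu).
have [h [Ih hE]] := conditional_expectation_law Sl I1.
have mh := Int_measurable Ih.
have bg n : bounded_measurable (fun s => trunc n (h s)).
  exact: (bounded_measurable_comp mh (bounded_measurable_trunc R n)).
have [||n||I2 leC] := @Rint_fatou _ _ _ l (fun n s => trunc n (h s) ^+ 2)
  (fun s => h s ^+ 2) C.
- by move=> n x; exact: sqr_ge0.
- by move=> n; apply: Int_bounded; exact: bounded_measurable_sqr.
- apply: le_trans (muC _ (bg n)); rewrite le_eqVlt; apply/orP; left; apply/eqP.
  have bS := bounded_measurable_comp Sl.1 (bg n).
  rewrite (Rint_score _ (bg n)).2 RintB; last 2 first.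
  + by apply: IntZ; exact: IntM_bounded.
  + by apply: Int_bounded; exact: bounded_measurable_sqr.
  rewrite RintZ; last exact: IntM_bounded.
  rewrite (hE _ (bg n)) -(has_law_Rint Sl (f := fun s => trunc n (h s) ^+ 2)); last 2 first.
  + by case: (bounded_measurable_sqr (bg n)).
  + by apply: Int_bounded; exact: bounded_measurable_sqr.
  under [X in _ = 2 * X - _]eq_Rintegral do rewrite -trunc_sqr.
  by ring.
- by move=> x; apply: cvgM; exact: trunc_cvg.
by exists h; split.
Qed.

End score.
(** * Properties of the attainable variances *)
Definition centered_le (R : realType) (mu : probability R R) (v : R) : Prop :=
  [/\ Int mu (fun y => y ^+ 2), \int[mu]_y y = 0 & \int[mu]_y y ^+ 2 <= v].

Lemma centered_le_Int (R : realType) (mu : probability R R) v :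
  centered_le mu v -> Int mu (fun y => y).
Proof. by move=> [I2 _ _]; exact: Int_sqr_Int. Qed.

Section centered_sum.
Context (R : realType) (m1 m2 l : probability R R).
Hypothesis Sl : has_law (m1 \x m2)%E (fun z => z.1 + z.2) l.

Lemma Int_fst (f : R -> R) : Int m1 f -> Int (m1 \x m2)%E (fun z => f z.1).
Proof.
by move=> If; exact: ((has_law_Int (has_law_fst m1 m2) (Int_measurable If)).1 If).
Qed.

Lemma Int_snd (f : R -> R) : Int m2 f -> Int (m1 \x m2)%E (fun z => f z.2).
Proof.
by move=> If; exact: ((has_law_Int (has_law_snd m1 m2) (Int_measurable If)).1 If).
Qed.

Lemma Rint_fst (f : R -> R) : Int m1 f ->
  \int[(m1 \x m2)%E]_z f z.1 = \int[m1]_x f x.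
Proof.
by move=> If; exact/esym/(has_law_Rint (has_law_fst m1 m2) (Int_measurable If) If).
Qed.

Lemma Rint_snd (f : R -> R) : Int m2 f ->
  \int[(m1 \x m2)%E]_z f z.2 = \int[m2]_x f x.
Proof.
by move=> If; exact/esym/(has_law_Rint (has_law_snd m1 m2) (Int_measurable If) If).
Qed.

(** The crude bound (a + b)^2 <= 2 a^2 + 2 b^2 is enough for the purpose of
    [explained_le_half], where only the finiteness of the result matters. *)
Lemma centered_sum v1 v2 : centered_le m1 v1 -> centered_le m2 v2 ->
  centered_le l (2 * v1 + 2 * v2).
Proof.
move=> c1 c2; have I1 := centered_le_Int c1; have I2 := centered_le_Int c2.
case: c1 c2 => [J1 E1 V1] [J2 E2 V2].
have m2' : measurable_fun setT (fun y : R => y ^+ 2) by exact: measurable_funX.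
have J1' := IntZ 2 (Int_fst J1); have J2' := IntZ 2 (Int_snd J2).
have JS : Int (m1 \x m2)%E (fun z : R * R => (z.1 + z.2) ^+ 2).
  apply: (Int_le _ _ (IntD J1' J2')).
    exact: (measurableT_comp m2' Sl.1).
  move=> z; rewrite ger0_norm ?sqr_ge0//.
  by have := sqr_ge0 (z.1 - z.2); nra.
have Jl : Int l (fun y => y ^+ 2) by apply/(has_law_Int Sl).
split => //.
- rewrite (has_law_Rint Sl)//; last exact: Int_sqr_Int.
  rewrite RintD; [|exact: (Int_fst I1)|exact: (Int_snd I2)].
  by rewrite (Rint_fst I1) (Rint_snd I2) E1 E2 addr0.
- rewrite (has_law_Rint Sl)//.
  apply: (@le_trans _ _ (\int[(m1 \x m2)%E]_z (2 * z.1 ^+ 2 + 2 * z.2 ^+ 2))).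
    by apply: Rint_le => //; [exact: IntD|move=> z; have := sqr_ge0 (z.1 - z.2); nra].
  rewrite RintD ?RintZ//; [|exact: (Int_snd J2)|exact: (Int_fst J1)].
  rewrite (Rint_fst (f := fun x => x ^+ 2))// (Rint_snd (f := fun x => x ^+ 2))//.
  by rewrite lerD// ler_pM2l.
Qed.

End centered_sum.

Section lower_bound.
Context (R : realType) (nu mu : probability R R) (s v C : R).
Hypotheses (cnu : centered_le nu s) (nuE : \int[nu]_x x ^+ 2 = s).
Hypotheses (cmu : centered_le mu v) (muC : explained_le nu mu C).

(** The constraint at the linear test function x |-> c x, reached as a limit of
    truncations.  Integrating in x first kills the cross term, because [nu] is
    centered. *)
Lemma explained_le_linear c : 2 * c * s - c ^+ 2 * (s + v) <= C.
Proof.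
have Inu := centered_le_Int cnu; have Imu := centered_le_Int cmu.
case: cnu cmu => [J1 E1 _] [J2 E2 V2].
have J1' := Int_fst mu J1; have J2' := Int_snd nu J2.
have bg n : bounded_measurable (fun x : R => c * trunc n x).
  apply: bounded_measurableM; first exact: bounded_measurable_cst.
  exact: bounded_measurable_trunc.
pose f z := 2 * (z.1 * (c * (z.1 + z.2))) - (c * (z.1 + z.2)) ^+ 2 : R.
pose bd (z : R * R) := (1 + 4 * c ^+ 2) * z.1 ^+ 2 + 4 * c ^+ 2 * z.2 ^+ 2.
have [|||| If cvf] := @Rint_dominated_cvg _ _ _ (nu \x mu)%E
  (fun n z => 2 * (z.1 * (c * trunc n (z.1 + z.2))) - (c * trunc n (z.1 + z.2)) ^+ 2)
  f bd.
- move=> n; apply: (@Int_measurable _ _ _ (nu \x mu)%E).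
  apply: (@Int_score_integrand _ _ _ (nu \x mu)%E (@fst R R)).
    exact: (Int_fst mu Inu).
  by apply: bounded_measurable_comp (bg n); exact: measurable_funD.
- move=> z; have h : c * trunc n (z.1 + z.2) @[n --> \oo] --> c * (z.1 + z.2).
    by apply: cvgM; [exact: cvg_cst|exact: trunc_cvg].
  apply: cvgB; last exact: cvgM.
  by apply: cvgM; [exact: cvg_cst|apply: cvgM => //; exact: cvg_cst].
- by apply: IntD; [exact: (IntZ _ J1')|exact: (IntZ _ J2')].
- move=> n z; rewrite /bd.
  have := norm_trunc_le n (z.1 + z.2).
  set u := trunc _ _; rewrite -ler_sqr ?nnegrE//.
  rewrite (@real_normK _ u) ?num_real// (@real_normK _ (z.1 + z.2)) ?num_real// => h.
  have h1 : (c * u) ^+ 2 <= c ^+ 2 * (z.1 + z.2) ^+ 2 by rewrite exprMn ler_wpM2l ?sqr_ge0.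
  have h2 := sqr_ge0 (z.1 - z.2).
  have h3 := sqr_ge0 (z.1 - c * u).
  have h4 := sqr_ge0 (z.1 + c * u).
  have h5 : c ^+ 2 * (z.1 + z.2) ^+ 2 <= c ^+ 2 * (2 * z.1 ^+ 2 + 2 * z.2 ^+ 2).
    by rewrite ler_wpM2l ?sqr_ge0//; nra.
  by rewrite ler_norml; apply/andP; split; nra.
have le1 : \int[(nu \x mu)%E]_z f z <= C.
  apply: (cvgr_to_le cvf); apply: nearW => n.
  by rewrite -(Rint_score Inu mu (bg n)).2; exact: muC.
apply: le_trans le1.
have fE y x : f (x, y) =
    (2 * c - c ^+ 2) * x ^+ 2 + 2 * (c - c ^+ 2) * y * x - c ^+ 2 * y ^+ 2.
  by rewrite /f /=; ring.
have Ify y : Int nu (fun x => (2 * c - c ^+ 2) * x ^+ 2 + 2 * (c - c ^+ 2) * y * x).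
  by apply: IntD; apply: IntZ.
have [|_ ->] := Rint_prod21 If.
  move=> y; under [X in _.-integrable _ (EFin \o X)]eq_fun do rewrite fE.
  by apply: IntB; [exact: Ify|exact: Int_cst].
rewrite (_ : (fun y => \int[nu]_x f (x, y)) =
    fun y => (2 * c - c ^+ 2) * s - c ^+ 2 * y ^+ 2).
  rewrite RintB; [|exact: Int_cst|exact: IntZ].
  rewrite Rint_cst RintZ//.
  by have := ler_wpM2l (sqr_ge0 c) V2; nra.
apply/funext => y; under eq_Rintegral do rewrite fE.
rewrite RintB; [|exact: Ify|exact: Int_cst].
rewrite RintD; [|exact: (IntZ _ J1)|exact: (IntZ _ Inu)].
by rewrite (RintZ _ J1) (RintZ _ Inu) Rint_cst nuE E1 mulr0 addr0.
Qed.

End lower_bound.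

Section no_noise.
Context (R : realType) (nu : probability R R) (s : R).
Hypotheses (cnu : centered_le nu s).

Lemma explained_le_no_noise :
  exists mu, centered_le mu 0 /\ explained_le nu mu s.
Proof.
have Inu := centered_le_Int cnu.
have mcst : measurable_fun setT (fun _ : R => 0 : R) by exact: measurable_cst.
have [mu mu0] := has_law_exists nu mcst.
have muE f : measurable_fun setT f -> Int mu f /\ \int[mu]_y f y = f 0.
  move=> mf; have If : Int mu f by apply/(has_law_Int mu0) => //; exact: Int_cst.
  by split => //; rewrite (has_law_Rint mu0)// Rint_cst.
exists mu; split.
  have [I1 E1] := muE _ (@measurable_id _ _ _).
  have [I2 E2] := muE (fun x => x ^+ 2) (measurable_funX 2 (@measurable_id _ _ _)).
  by split => //; rewrite E2 expr0n.
move=> g bg; have [Isc _] := Rint_score Inu mu bg.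
rewrite (muE _ (Int_measurable Isc)).2 /score.
case: cnu => J1 _; apply: le_trans; apply: Rint_le => //.
- apply: (@Int_score_integrand _ _ _ nu (fun x => x) (fun x => g (x + 0))) => //.
  by apply: bounded_measurable_comp bg; exact: measurable_funD.
- by move=> x; have := sqr_ge0 (x - g (x + 0)); nra.
Qed.

End no_noise.
Section mixture.
Context d (T : measurableType d) (R : realType).
Implicit Types m : {measure set T -> \bar R}.

Lemma Int_mscale m (k : {nonneg R}) (f : T -> R) : Int m f ->
  Int (mscale k m) f /\
  (\int[mscale k m]_x (f x)%:E = k%:num%:E * \int[m]_x (f x)%:E)%E.
Proof.
move=> /[dup] If /integrableP[mf foo].
split.
  apply/integrableP; split => //.
  rewrite ge0_integral_mscale//; last exact: measurableT_comp.
  by rewrite lte_mul_pinfty.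
rewrite (integralE _ _ (EFin \o f)) [in RHS](integralE _ _ (EFin \o f)).
rewrite (ge0_integral_mscale _ _ _ (measurable_funepos mf))//.
rewrite (ge0_integral_mscale _ _ _ (measurable_funeneg mf))//.
by rewrite -muleBr// integrable_add_def.
Qed.

Lemma Int_measure_add m1 m2 (f : T -> R) : Int m1 f -> Int m2 f ->
  Int (measure_add m1 m2) f.
Proof.
move=> /integrableP[mf foo1] /integrableP[_ foo2].
apply/integrableP; split => //.
rewrite ge0_integral_measure_add//; last exact: measurableT_comp.
exact: lte_add_pinfty.
Qed.

(** Randomizing the choice of the noise law by an independent coin. *)
Lemma mixture_exists (P1 P2 : probability T R) (t : R) : 0 <= t <= 1 ->
  exists P : probability T R, forall f, Int P1 f -> Int P2 f ->
    Int P f /\ \int[P]_x f x = (1 - t) * \int[P1]_x f x + t * \int[P2]_x f x.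
Proof.
move=> /andP[t0 t1].
have t1' : 0 <= 1 - t by rewrite subr_ge0.
pose m : {measure set T -> \bar R} :=
  measure_add (mscale (NngNum t1') P1) (mscale (NngNum t0) P2).
have mT : m setT = 1%E.
  rewrite /m /measure_add /= /msum !big_ord_recl big_ord0/= /mscale/=.
  rewrite [P1 _](_ : _ = 1%E); last exact: probability_setT.
  rewrite [P2 _](_ : _ = 1%E); last exact: probability_setT.
  by rewrite !mule1 adde0 -EFinD subrK.
pose mu : set T -> \bar R := m.
pose mmeas := isMeasure.Build _ T R mu (measure0 m) (measure_ge0 m)
  (@measure_semi_sigma_additive _ _ _ m).
pose mum : {measure set T -> \bar R} := HB.pack mu mmeas.
pose mprob := Measure_isProbability.Build _ T R mum mT.
pose P : probability T R := HB.pack mu mmeas mprob.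
exists P => f I1 I2.
have [J1 E1] := Int_mscale (NngNum t1') I1.
have [J2 E2] := Int_mscale (NngNum t0) I2.
split; first exact: (Int_measure_add J1 J2).
rewrite /Rintegral [X in fine X = _](_ : _ = \int[m]_x (f x)%:E)%E//.
rewrite (integral_measure_add measurableT J1 J2) E1 E2.
by rewrite -!/(Rintegral _ _ _) !EFin_Rint// -!EFinM -EFinD.
Qed.

End mixture.

Section convexity.
Context (R : realType) (nu mu1 mu2 : probability R R).
Variables (v1 v2 C1 C2 t : R).
Hypotheses (Inu : Int nu (fun x => x)) (t01 : 0 <= t <= 1).
Hypotheses (c1 : centered_le mu1 v1) (E1 : explained_le nu mu1 C1).
Hypotheses (c2 : centered_le mu2 v2) (E2 : explained_le nu mu2 C2).

Lemma explained_le_convex : exists mu,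
  centered_le mu ((1 - t) * v1 + t * v2) /\
  explained_le nu mu ((1 - t) * C1 + t * C2).
Proof.
have [mu muE] := mixture_exists mu1 mu2 t01.
have /andP[t0 t1] := t01.
have t1' : 0 <= 1 - t by rewrite subr_ge0.
exists mu; split.
  have I1 := centered_le_Int c1; have I2 := centered_le_Int c2.
  case: c1 c2 => [J1 M1 V1] [J2 M2 V2].
  have [I M] := muE _ I1 I2; have [J V] := muE _ J1 J2.
  split => //; first by rewrite M M1 M2 !mulr0 addr0.
  by rewrite V lerD// ler_wpM2l.
move=> g bg.
have [I1 _] := Rint_score Inu mu1 bg; have [I2 _] := Rint_score Inu mu2 bg.
by rewrite (muE _ I1 I2).2 lerD// ler_wpM2l//; [exact: E1|exact: E2].
Qed.

End convexity.

Section halving.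
Context (R : realType) (nu mu : probability R R) (s v C : R).
Hypotheses (cnu : centered_le nu s) (cmu : centered_le mu v).
Hypothesis muC : explained_le nu mu C.

(** The new noise is Y + S', with S' an independent copy of S = X + Y. Given S',
    a function of S + S' is a function of S, so X may be replaced by h(S); by
    symmetry also by h(S'), hence by their mean.  Completing the square bounds
    the functional by the second moment of (h(S) + h(S')) / 2, whose cross term
    vanishes since h(S) is centered. *)
Lemma explained_le_half : exists mu',
  centered_le mu' (6 * v + 4 * s) /\ explained_le nu mu' (C / 2).
Proof.
have Inu := centered_le_Int cnu.
have mS : measurable_fun setT (fun z : R * R => z.1 + z.2) by exact: measurable_funD.
have [l Sl] := has_law_exists (nu \x mu)%E mS.
have [mu' Sl'] := has_law_exists (mu \x l)%E mS.
have cl := centered_sum Sl cnu cmu.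
exists mu'; split.
  rewrite (_ : 6 * v + 4 * s = 2 * v + 2 * (2 * s + 2 * v)); last by ring.
  exact: (centered_sum Sl' cmu cl).
have [h [Ih Ih2 hC hE]] := explained_le_projection Inu Sl muC.
have mh := Int_measurable Ih.
have h0 : \int[l]_r h r = 0.
  have := hE _ (bounded_measurable_cst R 1).
  under eq_Rintegral do rewrite mulr1.
  under [X in _ = X -> _]eq_Rintegral do rewrite mulr1.
  by move=> <-; rewrite (Rint_fst mu Inu); case: cnu.
move=> g bg.
pose k (z : R * R) := g (z.1 + z.2).
have bk : bounded_measurable k by exact: (bounded_measurable_comp mS bg).
have bgs (y : R) : bounded_measurable (fun x : R => g (x + y)).
  by apply: bounded_measurable_comp bg; exact: measurable_funD.
have bgs' (y : R) : bounded_measurable (fun x : R => g (y + x)).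
  by apply: bounded_measurable_comp bg; exact: measurable_funD.
have Ih1 := Int_fst l Ih; have Ih1' := Int_snd l Ih.
(* The same functional with h(S), respectively h(S'), in place of X. *)
pose F1 z := 2 * (h z.1 * k z) - k z ^+ 2.
pose F2 z := 2 * (h z.2 * k z) - k z ^+ 2.
have IF1 : Int (l \x l)%E F1 by exact: Int_score_integrand.
have IF2 : Int (l \x l)%E F2 by exact: Int_score_integrand.
have IF1s y : Int l (fun x => F1 (x, y)) by exact: (Int_score_integrand Ih (bgs y)).
have IF2s y : Int l (fun x => F2 (y, x)) by exact: (Int_score_integrand Ih (bgs' y)).
have scoreE : \int[mu']_y score nu g y = \int[(l \x l)%E]_z F1 z.
  have [Isc _] := Rint_score Inu mu' bg.
  have msc := Int_measurable Isc.
  rewrite (has_law_Rint Sl' msc Isc).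
  have Isc' := (has_law_Int Sl' msc).1 Isc.
  have shift y : (fun x => score nu g (x + y)) = score nu (fun x => g (x + y)).
    by apply/funext => x; apply: eq_Rintegral => r _; rewrite addrA.
  have [|_ ->] := Rint_prod21 Isc'.
    by move=> y /=; rewrite (shift y); exact: (Rint_score Inu mu (bgs y)).1.
  have [_ ->] := Rint_prod21 IF1 IF1s.
  apply: eq_Rintegral => y _ /=.
  rewrite (shift y) (Rint_score Inu mu (bgs y)).2.
  have bS := bounded_measurable_comp Sl.1 (bgs y).
  have bq := bounded_measurable_sqr (bgs y).
  have Ifst := Int_fst mu Inu.
  rewrite RintB; last 2 first.
  - exact: (IntZ 2 (IntM_bounded Ifst bS)).
  - exact: (Int_bounded _ (bounded_measurable_sqr bS)).
  rewrite (RintZ _ (IntM_bounded Ifst bS)) (hE _ (bgs y)).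
  rewrite -(has_law_Rint Sl bq.1 (Int_bounded _ bq)).
  rewrite /F1 /k /= RintB; [|exact: (IntZ _ (IntM_bounded Ih (bgs y)))|exact: Int_bounded].
  by rewrite (RintZ _ (IntM_bounded Ih (bgs y))).
have symE : \int[(l \x l)%E]_z F1 z = \int[(l \x l)%E]_z F2 z.
  have [_ ->] := Rint_prod21 IF1 IF1s.
  have [_ ->] := Rint_prod12 IF2 IF2s.
  apply: eq_Rintegral => y _; apply: eq_Rintegral => x _.
  by rewrite /F1 /F2 /k/= [x + y]addrC.
have Ihsq1 := Int_fst l Ih2; have Ihsq2 := Int_snd l Ih2.
pose H z : R := h z.1 * h z.2.
have IH : Int (l \x l)%E H.
  apply: (Int_le _ _ (IntD Ihsq1 Ihsq2)).
    by apply: measurable_funM; exact: (Int_measurable (P := (l \x l)%E)).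
  move=> z; rewrite /H ler_norml; apply/andP; split.
    by have := sqr_ge0 (h z.1 + h z.2); have := sqr_ge0 (h z.1); have := sqr_ge0 (h z.2); nra.
  by have := sqr_ge0 (h z.1 - h z.2); have := sqr_ge0 (h z.1); have := sqr_ge0 (h z.2); nra.
have H0 : \int[(l \x l)%E]_z H z = 0.
  have [|_ ->] := Rint_prod12 IH; first by move=> x; exact: (IntZ (h x) Ih).
  under eq_Rintegral do rewrite /H /= (RintZ _ Ih) h0 mulr0.
  by rewrite Rint_cst.
rewrite scoreE.
(* The square of (h(S) + h(S')) / 2. *)
pose B z := 4^-1 * (h z.1 ^+ 2 + h z.2 ^+ 2) + 2^-1 * H z.
have IB : Int (l \x l)%E B.
  exact: (IntD (IntZ 4^-1 (IntD Ihsq1 Ihsq2)) (IntZ 2^-1 IH)).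
have BE : \int[(l \x l)%E]_z B z <= C / 2.
  rewrite RintD; [|exact: (IntZ 4^-1 (IntD Ihsq1 Ihsq2))|exact: (IntZ 2^-1 IH)].
  rewrite (RintZ _ IH) H0 mulr0 addr0 (RintZ _ (IntD Ihsq1 Ihsq2)).
  rewrite (RintD Ihsq1 Ihsq2) (Rint_fst l Ih2) (Rint_snd l Ih2).
  by lra.
apply: le_trans BE.
have -> : \int[(l \x l)%E]_z F1 z = \int[(l \x l)%E]_z (2^-1 * F1 z + 2^-1 * F2 z).
  rewrite [RHS]RintD; [|exact: (IntZ 2^-1 IF1)|exact: (IntZ 2^-1 IF2)].
  by rewrite (RintZ _ IF1) (RintZ _ IF2) -symE; lra.
apply: Rint_le => //; first exact: (IntD (IntZ 2^-1 IF1) (IntZ 2^-1 IF2)).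
move=> z; rewrite /F1 /F2 /B /H.
by have := sqr_ge0 ((h z.1 + h z.2) / 2 - k z); nra.
Qed.

End halving.
(** * From laws of the noise to noise variables *)
Lemma variance_centered d (T : measurableType d) (R : realType)
    (P : probability T R) (Z : T -> R) : (\int[P]_w (Z w)%:E = 0)%E ->
  ('V_P[Z] = \int[P]_w (Z w ^+ 2)%:E)%E.
Proof.
move=> Z0; rewrite /variance unlock; set c := fine _.
have -> : c = 0 by rewrite /c unlock Z0.
rewrite unlock; apply: eq_integral => w _ /=.
by rewrite -[in RHS](subr0 (Z w)).
Qed.

Section has_law_comp.
Context d1 d2 d3 (T : measurableType d1) (U : measurableType d2)
  (V : measurableType d3) (R : realType).

Lemma has_law_comp (P : probability T R) (Q : probability U R)
    (L : probability V R) (X : T -> U) (Y : U -> V) :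
  has_law P X Q -> has_law Q Y L -> has_law P (Y \o X) L.
Proof.
move=> [mX XE] [mY YE]; split; first exact: measurableT_comp.
move=> B mB; rewrite -YE// -XE//.
by rewrite -[X in measurable X]setTI; exact: mY.
Qed.

End has_law_comp.

Lemma EFin_Rint_in d (T : measurableType d) (R : realType) (P : probability T R)
    (A : set T) (f : T -> R) : measurable A -> Int P f ->
  (\int[P]_(x in A) (f x)%:E)%E = (\int[P]_x (f x * \1_A x))%:E.
Proof.
move=> mA If; rewrite -Rint_indic /Rintegral fineK//.
by apply: integrable_fin_num => //; exact: integrableS If.
Qed.

Section conditional_variance.
Context d (T : measurableType d) (R : realType) (P : probability T R).
Variables (X Y Z : T -> R) (nu mu : probability R R) (s : R).
Hypotheses (Xnu : has_law P X nu) (Ymu : has_law P Y mu) (XY : indep_RV P X Y).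
Hypotheses (cnu : centered_le nu s).
Hypothesis ZE : is_cond_exp P X (sigma_RV (fun w => X w + Y w)) Z.

(** Projection inequality 2 Z g - g^2 <= Z^2, integrated after replacing X by
    its conditional expectation Z against g(S).  Infinite values of the variance
    are harmless in an infimum. *)
Lemma variance_cond_exp : 'V_P[Z]%E = +oo%E \/
  exists C : R, explained_le nu mu C /\ 'V_P[Z]%E = C%:E.
Proof.
have Inu := centered_le_Int cnu.
pose S w := X w + Y w.
have mS : measurable_fun setT S by exact: measurable_funD Xnu.1 Ymu.1.
have XYl := has_law_pair Xnu Ymu XY.
have IX : Int P X by exact: ((has_law_Int Xnu (@measurable_id _ R setT)).1 Inu).
have [_ IZ ZXE] := ZE.
have mSB B : measurable B -> measurable (S @^-1` B).
  by move=> mB; rewrite -[X in measurable X]setTI; exact: mS.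
have levels B : measurable B -> \int[P]_w (Z w * \1_B (S w)) = \int[P]_w (X w * \1_B (S w)).
  move=> mB; apply: EFin_inj.
  have := ZXE (S @^-1` B); rewrite (EFin_Rint_in (mSB B mB) IZ) (EFin_Rint_in (mSB B mB) IX).
  by apply; exists B => //; rewrite setTI.
have testE g : bounded_measurable g -> \int[P]_w (Z w * g (S w)) = \int[P]_w (X w * g (S w)).
  move=> bg; have bgS := bounded_measurable_comp mS bg.
  have := @Rint_bounded_eq0 _ _ _ _ _ P S (fun w => Z w - X w) mS (IntB IZ IX) _ g bg.
  under eq_Rintegral do rewrite mulrBl.
  rewrite RintB; [|exact: IntM_bounded..] => /(_ _)/subr0_eq; apply => B mB.
  have bBS := bounded_measurable_comp mS (bounded_measurable_indic R mB).
  under eq_Rintegral do rewrite mulrBl.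
  by rewrite RintB ?levels ?subrr//; exact: IntM_bounded.
have Z0 : (\int[P]_w (Z w)%:E = 0)%E.
  have := testE _ (bounded_measurable_cst R 1).
  under eq_Rintegral do rewrite mulr1.
  under [X in _ = X -> _]eq_Rintegral do rewrite mulr1.
  rewrite EFin_Rint// => ->; rewrite -(has_law_Rint Xnu (f := fun x => x))//.
  by case: cnu => _ ->.
rewrite (variance_centered Z0).
have mZ2 : measurable_fun setT (fun w => Z w ^+ 2).
  by apply: measurable_funX; exact: Int_measurable IZ.
have := leey (\int[P]_w (Z w ^+ 2)%:E)%E; rewrite le_eqVlt => /predU1P[->|fin]; first by left.
have IZ2 : Int P (fun w => Z w ^+ 2).
  apply/integrableP; split; first exact/measurable_EFinP.
  apply: le_lt_trans fin; rewrite le_eqVlt; apply/orP; left; apply/eqP.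
  by apply: eq_integral => w _ /=; rewrite ger0_norm// sqr_ge0.
right; exists (\int[P]_w Z w ^+ 2); split; last by rewrite EFin_Rint.
move=> g bg.
have bgS := bounded_measurable_comp mS bg.
have bS' : bounded_measurable (fun z : R * R => g (z.1 + z.2)).
  by apply: bounded_measurable_comp bg; exact: measurable_funD.
rewrite (Rint_score Inu mu bg).2 (has_law_Rint XYl); last 2 first.
- apply: (@Int_measurable _ _ _ (nu \x mu)%E).
  by apply: Int_score_integrand bS'; exact: (Int_fst mu Inu).
- by apply: Int_score_integrand bS'; exact: (Int_fst mu Inu).
rewrite /= RintB; last 2 first.
- exact: (IntZ 2 (IntM_bounded IX bgS)).
- exact: (Int_bounded P (bounded_measurable_sqr bgS)).
rewrite (RintZ 2 (IntM_bounded IX bgS)) -(testE g bg) -(RintZ 2 (IntM_bounded IZ bgS)).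
rewrite -RintB; last 2 first.
- exact: (IntZ 2 (IntM_bounded IZ bgS)).
- exact: (Int_bounded P (bounded_measurable_sqr bgS)).
apply: Rint_le => //; first exact: Int_score_integrand.
by move=> w; have := sqr_ge0 (Z w - g (S w)); rewrite /S; nra.
Qed.

End conditional_variance.

Section realization.
Context d (T : measurableType d) (R : realType) (P : probability T R).
Variables (X : T -> R) (nu mu : probability R R) (s e C : R).
Hypotheses (Xnu : has_law P X nu).
Hypotheses (cnu : centered_le nu s) (cmu : centered_le mu (e ^+ 2)).
Hypothesis muC : explained_le nu mu C.

(** The product of the given space with the line carrying [mu] is an
    enlargement on which the noise and the conditional expectation exist. *)
Lemma inf_var_cond_exp_le : (inf_var_cond_exp P X e <= C%:E)%E.
Proof.
have Inu := centered_le_Int cnu; have Imu := centered_le_Int cmu.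
pose Q : probability (T * R)%type R := (P \x mu)%E.
have XfQ : has_law Q (X \o fst) nu := has_law_comp (has_law_fst P mu) Xnu.
have sndQ : has_law Q snd mu := has_law_snd P mu.
have ind : indep_RV Q (X \o fst) snd.
  move=> A B mA mB; rewrite (XfQ.2 A mA) (sndQ.2 B mB) -(Xnu.2 A mA).
  have mXA : measurable (X @^-1` A).
    by rewrite -[X in measurable X]setTI; exact: Xnu.1.
  exact: (@product_measure1E _ _ T R R P mu (X @^-1` A) B mXA mB).
have XYl := has_law_pair XfQ sndQ ind.
have mS : measurable_fun setT (fun z : R * R => z.1 + z.2) by exact: measurable_funD.
have [l Sl] := has_law_exists (nu \x mu)%E mS.
have SQ : has_law Q (fun w => (X \o fst) w + w.2) l := has_law_comp XYl Sl.
have [h [Ih Ih2 hC hE]] := explained_le_projection Inu Sl muC.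
have mh := Int_measurable Ih.
pose Y := mfun_of sndQ.1.
pose Z w := h ((X \o fst) w + w.2).
have IX : Int Q (X \o fst) by exact: ((has_law_Int XfQ (@measurable_id _ R setT)).1 Inu).
have IZ : Int Q Z by exact: ((has_law_Int SQ mh).1 Ih).
have mh2 : measurable_fun setT (fun x => h x ^+ 2) by exact: measurable_funX.
have IZ2 : Int Q (fun w => Z w ^+ 2) by exact: ((has_law_Int SQ mh2).1 Ih2).
have hgE g : bounded_measurable g ->
    \int[Q]_w (Z w * g ((X \o fst) w + w.2)) =
    \int[Q]_w ((X \o fst) w * g ((X \o fst) w + w.2)).
  move=> bg.
  rewrite -[LHS](has_law_Rint SQ (f := fun x => h x * g x)); last 2 first.
  - by apply: measurable_funM => //; case: bg.
  - exact: IntM_bounded.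
  rewrite -hE//.
  have I1 : Int (nu \x mu)%E (fun z : R * R => z.1 * g (z.1 + z.2)).
    by apply: (IntM_bounded (Int_fst mu Inu)); exact: bounded_measurable_comp.
  by rewrite (has_law_Rint XYl (Int_measurable I1) I1).
have Z0 : (\int[Q]_w (Z w)%:E = 0)%E.
  have := hgE _ (bounded_measurable_cst R 1).
  under eq_Rintegral do rewrite mulr1.
  under [X in _ = X -> _]eq_Rintegral do rewrite mulr1.
  rewrite EFin_Rint// => ->; rewrite -(has_law_Rint XfQ (f := fun x => x))//.
  by case: cnu => _ ->.
apply: (@le_trans _ _ ('V_Q[Z])%E); last first.
  rewrite (variance_centered Z0) EFin_Rint// lee_fin.
  by rewrite -(has_law_Rint SQ mh2 Ih2).
apply: ereal_inf_lbound.
exists _, (T * R)%type, Q, fst, Y, Z; split => //.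
- split; first exact: measurable_fst.
  by move=> A mA; exact: (has_law_fst P mu).2.
- split => //.
  + rewrite unlock /=.
    have I := (has_law_Int sndQ (@measurable_id _ R setT)).1 Imu.
    rewrite (EFin_Rint I) -(has_law_Rint sndQ (f := fun x => x))//.
    by case: cmu => _ ->.
  + rewrite unlock /=; case: cmu => I2 _ V2.
    have m2 : measurable_fun setT (fun x : R => x ^+ 2) by exact: measurable_funX.
    have I := (has_law_Int sndQ m2).1 I2.
    by rewrite (EFin_Rint I) -(has_law_Rint sndQ m2 I2) lee_fin.
- split => //.
  + move=> B mB; exists (h @^-1` B); last by rewrite setTI.
    by rewrite -[X in measurable X]setTI; exact: mh.
  + move=> A [B mB <-]; rewrite setTI.
    have mSB : measurable ((fun w : T * R => (X \o fst) w + w.2) @^-1` B).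
      by rewrite -[X in measurable X]setTI; exact: SQ.1.
    rewrite (EFin_Rint_in mSB IZ) (EFin_Rint_in mSB IX).
    by congr EFin; exact: hgE (bounded_measurable_indic R mB).
Qed.

End realization.
(** * Strict decrease and right continuity *)
Section attainable.
Context (R : realType) (nu : probability R R) (s : R).
Hypotheses (cnu : centered_le nu s) (nuE : \int[nu]_x x ^+ 2 = s).

Definition attainable (v C : R) : Prop :=
  exists mu, centered_le mu v /\ explained_le nu mu C.

Lemma attainable_mono v w C : v <= w -> attainable v C -> attainable w C.
Proof.
move=> vw [mu [[I M V] E]]; exists mu; split => //.
by split => //; exact: le_trans vw.
Qed.

Lemma attainable0 : attainable 0 s.
Proof. exact: explained_le_no_noise. Qed.

Lemma attainable_convex v w C D t : 0 <= t <= 1 ->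
  attainable v C -> attainable w D ->
  attainable ((1 - t) * v + t * w) ((1 - t) * C + t * D).
Proof.
move=> t01 [mu1 [c1 E1]] [mu2 [c2 E2]].
exact: (explained_le_convex (centered_le_Int cnu) t01 c1 E1 c2 E2).
Qed.

Lemma attainable_half v C : attainable v C -> attainable (6 * v + 4 * s) (C / 2).
Proof. by move=> [mu [c1 E1]]; exact: (explained_le_half cnu c1 E1). Qed.

Lemma attainable_ge v C c : attainable v C -> 2 * c * s - c ^+ 2 * (s + v) <= C.
Proof. by move=> [mu [c1 E1]]; exact: (explained_le_linear cnu nuE c1 E1). Qed.

Lemma attainable_ge0 v C : attainable v C -> 0 <= C.
Proof. by move=> /(attainable_ge 0); rewrite mulr0 mul0r expr0n/= mul0r subr0. Qed.

End attainable.

Section value.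
Context d (R : realType) (T : measurableType d) (P : probability T R).
Variables (X : T -> R) (nu : probability R R) (s : R).
Hypotheses (Xnu : has_law P X nu) (cnu : centered_le nu s).

Definition value (e : R) : R := fine (inf_var_cond_exp P X e).

Lemma valueE e : (inf_var_cond_exp P X e = (value e)%:E)%E.
Proof.
rewrite /value fineK// fin_numE; apply/andP; split.
  rewrite -ltNye; apply: (@lt_le_trans _ _ 0%E) => //.
  apply: le_ereal_inf_tmp => _ [d' [T' [P' [p [Y [Z [_ _ _ ->]]]]]]].
  exact: variance_ge0.
rewrite -ltey; apply: (@le_lt_trans _ _ s%:E); last exact: ltry.
have [mu [c E]] : attainable nu (e ^+ 2) s.
  by apply: attainable_mono (attainable0 cnu); exact: sqr_ge0.
exact: inf_var_cond_exp_le Xnu cnu c E.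
Qed.

Lemma value_le e C : attainable nu (e ^+ 2) C -> value e <= C.
Proof.
move=> [mu [c E]]; rewrite -lee_fin -valueE.
exact: inf_var_cond_exp_le Xnu cnu c E.
Qed.

Lemma value_ge e b : (forall C, attainable nu (e ^+ 2) C -> b <= C) ->
  b <= value e.
Proof.
move=> H; rewrite -lee_fin -valueE; apply: le_ereal_inf_tmp.
move=> _ [d' [T' [P' [p [Y [Z [[mp pE] [XY Y0 Y2] ZE ->]]]]]]].
have Xp : has_law P' (X \o p) nu by apply: has_law_comp Xnu; split.
have mY : measurable_fun setT (Y : T' -> R) by exact: measurable_funP.
have [mu Ymu] := has_law_exists P' mY.
have [->|[C [E ->]]] := variance_cond_exp Xp Ymu XY cnu ZE; first exact: leey.
rewrite lee_fin; apply: H; exists mu; split => //.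
move: Y0 Y2; rewrite !unlock /= => Y0 Y2.
have m2 : measurable_fun setT (fun x : R => x ^+ 2) by exact: measurable_funX.
have IY2 : Int P' (fun w => Y w ^+ 2).
  by apply: ge0_Int Y2 => // [|w]; [exact: measurable_funX|exact: sqr_ge0].
have I2 : Int mu (fun y => y ^+ 2) by exact: ((has_law_Int Ymu m2).2 IY2).
have I1 : Int mu (fun y => y) by exact: Int_sqr_Int.
have IY : Int P' (Y : T' -> R) by exact: ((has_law_Int Ymu (@measurable_id _ R setT)).1 I1).
split => //.
- by rewrite (has_law_Rint Ymu _ I1)//; rewrite (EFin_Rint IY) in Y0; case: Y0.
- by rewrite (has_law_Rint Ymu m2 I2) -lee_fin -(EFin_Rint IY2).
Qed.

End value.

Section monotonicity_continuity.
Context d (R : realType) (T : measurableType d) (P : probability T R).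
Variables (X : T -> R) (nu : probability R R) (s : R).
Hypotheses (Xnu : has_law P X nu) (cnu : centered_le nu s).
Hypotheses (nuE : \int[nu]_x x ^+ 2 = s) (s0 : 0 < s).
Local Notation l := (value P X).

(** The optimal linear coefficient c = s / (s + e^2) gives the linear estimation
    bound s^2 / (s + e^2). *)
Lemma value_gt0 (e : R) : 0 < l e.
Proof.
have v0 := sqr_ge0 e; have sv : 0 < s + e ^+ 2 by rewrite ltr_wpDr.
apply: (@lt_le_trans _ _ (s ^+ 2 / (s + e ^+ 2))); first by rewrite divr_gt0// exprn_gt0.
apply: (value_ge Xnu cnu) => C /(attainable_ge cnu nuE (s / (s + e ^+ 2))).
apply: le_trans; rewrite le_eqVlt; apply/orP; left; apply/eqP.
by field; rewrite gt_eqF.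
Qed.

(** The noise is mixed with the one of [attainable_half], with a weight [t] small
    enough to keep the second moment below e2^2; this multiplies the attained
    variance by 1 - t / 2. *)
Lemma value_decreasing (e1 e2 : R) : 0 <= e1 -> e1 < e2 -> l e2 < l e1.
Proof.
move=> e10 e12.
have vw : (e1 ^+ 2 : R) < e2 ^+ 2 by rewrite ltr_pXn2r ?nnegrE// ltW// (le_lt_trans e10).
have v0 : 0 <= e1 ^+ 2 := sqr_ge0 e1.
(* With t = (e2^2 - e1^2) / D, the displacement t (5 e1^2 + 4 s) of the second
   moment is at most e2^2 - e1^2, and t <= 1. *)
pose D : R := e2 ^+ 2 - e1 ^+ 2 + (5 * e1 ^+ 2 + 4 * s).
have D0 : 0 < D by have := s0; rewrite /D; lra.
pose t : R := (e2 ^+ 2 - e1 ^+ 2) / D.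
have tD : t * D = e2 ^+ 2 - e1 ^+ 2 by rewrite /t divfK// gt_eqF.
have t0 : 0 < t by rewrite divr_gt0// subr_gt0.
have t1 : t <= 1 by have := s0; rewrite ler_pdivrMr// mul1r /D; lra.
have l0 := value_gt0 e1.
suff : l e2 / (1 - t / 2) <= l e1.
  rewrite ler_pdivrMr; last by lra.
  move=> /le_lt_trans; apply; rewrite -[ltRHS]mulr1 ltr_pM2l//.
  by lra.
apply: (value_ge Xnu cnu) => C aC; rewrite ler_pdivrMr; last by lra.
apply: (value_le Xnu cnu).
have t01 : 0 <= t <= 1 by rewrite t1 ltW.
have := attainable_convex cnu t01 aC (attainable_half cnu aC).
rewrite (_ : (1 - t) * C + t * (C / 2) = C * (1 - t / 2)); last by field.
apply: attainable_mono; move: tD s0; rewrite /D; nra.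
Qed.

(** A one-sided Lipschitz bound in the variable x^2.  For e > 0, a noise of second
    moment x^2 is mixed with no noise so as to return to second moment e^2.  At
    e = 0 that mixture is trivial, and the linear bound with c = 1 takes over. *)
Lemma value_increment (e : R) : 0 <= e -> exists k, forall x, e < x ->
  l e <= l x + k * (x ^+ 2 - e ^+ 2).
Proof.
rewrite le_eqVlt => /predU1P[<-|e0].
  exists 1 => x x0; rewrite expr0n/= subr0 mul1r -lerBlDr.
  apply: (value_ge Xnu cnu) => C /(attainable_ge cnu nuE 1); apply: le_trans.
  have : l 0 <= s by apply: (value_le Xnu cnu); rewrite expr0n; exact: attainable0.
  by lra.
exists (s / e ^+ 2) => x ex; rewrite -lerBlDr.
have e2 : 0 < e ^+ 2 by rewrite exprn_gt0.
have ex2 : e ^+ 2 < x ^+ 2 by rewrite ltr_pXn2r ?nnegrE// ltW// (lt_trans e0).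
have x2 : 0 < x ^+ 2 by exact: lt_trans ex2.
apply: (value_ge Xnu cnu) => C aC; have C0 := attainable_ge0 cnu nuE aC.
rewrite lerBlDr.
pose t : R := 1 - e ^+ 2 / x ^+ 2.
have q : e ^+ 2 / x ^+ 2 * x ^+ 2 = e ^+ 2 by rewrite divfK// gt_eqF.
have t01 : 0 <= t <= 1.
  have q0 : 0 <= e ^+ 2 / x ^+ 2 by rewrite divr_ge0// ltW.
  have q1 : e ^+ 2 / x ^+ 2 <= 1 by rewrite ler_pdivrMr// mul1r ltW.
  by rewrite /t; lra.
have := attainable_convex cnu t01 aC (attainable0 cnu).
rewrite mulr0 addr0 (_ : (1 - t) * x ^+ 2 = e ^+ 2); last by rewrite /t subKr.
move=> /(value_le Xnu cnu)/le_trans; apply.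
have /andP[t0 t1] := t01.
apply: lerD; first by nra.
rewrite mulrC -mulrA ler_wpM2l ?(ltW s0)//.
rewrite (_ : t = (x ^+ 2 - e ^+ 2) / x ^+ 2); last first.
  by rewrite /t mulrBl divff// gt_eqF.
rewrite mulrC ler_wpM2r ?subr_ge0 ?(ltW ex2)//.
by rewrite lef_pV2// ltW.
Qed.

Lemma value_right_continuous (e : R) : 0 <= e -> l x @[x --> e^'+] --> l e.
Proof.
move=> e0; have [k H] := value_increment e0.
apply: (@squeeze_cvgr _ _ _ _ (fun x => l e - k * (x ^+ 2 - e ^+ 2)) (fun=> l e)).
- near=> x; have ex : e < x by near: x; exact: nbhs_right_gt.
  by rewrite lerBlDr H//= ltW// value_decreasing.
- rewrite -[X in _ --> X]subr0; apply: cvgB; first exact: cvg_cst.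
  rewrite -(mulr0 k); apply: cvgM; first exact: cvg_cst.
  rewrite -(subrr (e ^+ 2)); apply: cvgB; last exact: cvg_cst.
  by apply: cvgM; exact: cvg_at_right_filter (@cvg_id _ _).
- exact: cvg_cst.
Unshelve. all: end_near. Qed.

End monotonicity_continuity.

Lemma second_moment_gt0 d (T : measurableType d) (R : realType)
    (P : probability T R) (X : {RV P >-> R}) :
  nondegenerate_RV P X -> (0 < \int[P]_w (X w ^+ 2)%:E)%E.
Proof.
move=> nd; rewrite lt_neqAle integral_ge0 ?andbT; last first.
  by move=> w _; rewrite lee_fin sqr_ge0.
apply/eqP => I0; apply: nd; exists 0.
have mX2 : measurable_fun setT (fun w => (X w ^+ 2)%:E).
  by apply/measurable_EFinP; exact: measurable_funX.
have : ae_eq P setT (fun w => (X w ^+ 2)%:E) (cst 0%E).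
  apply/(ae_eq_integral_abs P measurableT mX2); rewrite [RHS]I0.
  by apply: eq_integral => w _ /=; rewrite ger0_norm// sqr_ge0.
apply: filterS => w /= /(_ I) [] /eqP; rewrite sqrf_eq0 => /eqP; exact.
Qed.

Theorem theorem10 (R : realType) (d : measure_display) (T : measurableType d)
    (P : probability T R) (X : {RV P >-> R})
    (X_nondeg : nondegenerate_RV P X)
    (X_mean : ('E_P[X : T -> R] = 0)%E)
    (X_sq : ('E_P[fun w => (X w ^+ 2)%R] < +oo)%E) :
  (forall e1 e2 : R, 0 <= e1 -> e1 < e2 ->
     (inf_var_cond_exp P X e2 < inf_var_cond_exp P X e1)%E) /\
  (forall e : R, 0 <= e ->
     inf_var_cond_exp P X x @[x --> e^'+] --> inf_var_cond_exp P X e).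
Proof.
move: X_mean X_sq; rewrite !unlock => X0 X2.
have := second_moment_gt0 X_nondeg.
have mX : measurable_fun setT (X : T -> R) by exact: measurable_funP.
have [nu Xnu] := has_law_exists P mX.
have m2 : measurable_fun setT (fun x : R => x ^+ 2) by exact: measurable_funX.
have IX2 : Int P (fun w => X w ^+ 2).
  apply/integrableP; split; first by apply/measurable_EFinP; exact: measurable_funX.
  apply: le_lt_trans X2; rewrite le_eqVlt; apply/orP; left; apply/eqP.
  by apply: eq_integral => w _ /=; rewrite ger0_norm// sqr_ge0.
have I2 : Int nu (fun y => y ^+ 2) by exact: ((has_law_Int Xnu m2).2 IX2).
have I1 : Int nu (fun y => y) by exact: Int_sqr_Int.
have IX : Int P (X : T -> R) by exact: ((has_law_Int Xnu (@measurable_id _ R setT)).1 I1).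
rewrite (EFin_Rint IX2) -(has_law_Rint Xnu m2 I2) lte_fin => s0.
have cnu : centered_le nu (\int[nu]_y y ^+ 2).
  split => //; rewrite (has_law_Rint Xnu _ I1)//.
  by rewrite (EFin_Rint IX) in X0; case: X0.
split=> [e1 e2 e10 e12|e e0].
  rewrite !(valueE Xnu cnu) lte_fin.
  exact: (value_decreasing Xnu cnu erefl s0).
rewrite (valueE Xnu cnu); under eq_fun do rewrite (valueE Xnu cnu).
apply: cvg_EFin; first exact: nearW.
exact: (value_right_continuous Xnu cnu erefl s0).
Qed.
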